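(* For any integer $n\geq 0$, $$\sum_{k=-n}^{n}\left[{2n \atop n+k}\right]_q (-1)^k q^{(5k-1)k/2}=\left[{2n\atop n}\right]_q\,(q;q)_n\sum_{k=0}^{n}\left[{n \atop k}\right]_q q^{k^2}.$$
   Context: $q$ is a complex number with $0<|q|<1$. For an integer $n\ge 0$, $(a;q)_n=\prod_{j=0}^{n-1}(1-aq^j)$, and the $q$-binomial coefficient is $\left[{n\atop k}\right]_q=\frac{(q;q)_n}{(q;q)_k(q;q)_{n-k}}$ for $0\le k\le n$. *)

(* Defs.v *)
From HB Require Import structures.
From mathcomp Require Import all_boot all_order all_algebra.
From mathcomp Require Import complex reals.

Set Implicit Arguments.
Unset Strict Implicit.
Unset Printing Implicit Defensive.

Import Order.TTheory GRing.Theory Num.Theory.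
Local Open Scope ring_scope.

Definition qpoch (F : fieldType) (a q : F) (n : nat) : F :=
  \prod_(j < n) (1 - a * q ^+ j).

(* Only meaningful for k <= n: subtraction on nat is truncated. *)
Definition qbinom (F : fieldType) (q : F) (n k : nat) : F :=
  qpoch q q n / (qpoch q q k * qpoch q q (n - k)).

Definition symrange (n : nat) : seq int :=
  [seq i%:Z - n%:Z | i <- iota 0 (2 * n).+1].

(* Main.v *)
(** With [1/(q;q)_m = 0] for [m < 0], the sequences [alpha], [beta] form a
    Bailey pair when [beta_n = \sum_r alpha_r / ((q;q)_(n-r) (q;q)_(n+r))],
    [r] ranging over the integers.  The q-Vandermonde sum shows that
    [q^(r^2) alpha_r] is then paired with
    [\sum_k q^(k^2) beta_k / (q;q)_(n-k)].  By the q-binomial theorem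
    [(-1)^r q^(r(r-1)/2)] is paired with the indicator of [n = 0]; two
    applications of the Bailey step to this pair give the identity, divided by
    [(q;q)_(2n)]. *)
Require Import Defs.
From HB Require Import structures.
From mathcomp Require Import all_boot all_order all_algebra.
From mathcomp Require Import complex reals.
From mathcomp Require Import zify ring.

Set Implicit Arguments.
Unset Strict Implicit.
Unset Printing Implicit Defensive.

Import Order.TTheory GRing.Theory Num.Theory.
Local Open Scope ring_scope.

Lemma symrange_sumE (V : nmodType) (n : nat) (f : int -> V) :
  \sum_(r <- symrange n) f r = \sum_(i < (2 * n).+1) f (i%:Z - n%:Z).
Proof.
rewrite -(big_mkord xpredT (fun i => f (i%:Z - n%:Z))) /index_iota subn0.
by rewrite /symrange big_map.
Qed.

Lemma symrange_sum_recr (V : nmodType) (n : nat) (f : int -> V) :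
  \sum_(r <- symrange n.+1) f r =
  f (- n.+1%:Z) + \sum_(r <- symrange n) f r + f n.+1%:Z.
Proof.
rewrite !symrange_sumE mulnS !addSn add0n big_ord_recr big_ord_recl /=.
congr (_ + _ + _); last by congr f; lia.
  by congr f; lia.
by apply: eq_bigr => i _; congr f; rewrite /bump /=; lia.
Qed.

Lemma symrange_sum_widen (V : nmodType) (n N : nat) (f : int -> V) :
  (n <= N)%N -> (forall r : int, (n < absz r)%N -> f r = 0) ->
  \sum_(r <- symrange N) f r = \sum_(r <- symrange n) f r.
Proof.
move=> + f0; elim: N => [|N IHN]; first by rewrite leqn0 => /eqP->.
rewrite leq_eqVlt ltnS => /predU1P[-> // | le_nN].
rewrite symrange_sum_recr IHN // !f0 ?add0r ?addr0 //; lia.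
Qed.

Lemma qpochS (F : fieldType) (a q : F) (n : nat) :
  qpoch a q n.+1 = qpoch a q n * (1 - a * q ^+ n).
Proof. exact: big_ord_recr. Qed.

Lemma qpoch0 (F : fieldType) (a q : F) : qpoch a q 0 = 1.
Proof. exact: big_ord0. Qed.

Lemma qpochSl (F : fieldType) (a q : F) (n : nat) :
  qpoch a q n.+1 = (1 - a) * qpoch (a * q) q n.
Proof.
rewrite /qpoch big_ord_recl /= mulr1; congr (_ * _).
by apply: eq_bigr => i _; rewrite /bump /= exprS mulrA.
Qed.

Lemma qpoch_eq0 (F : fieldType) (q : F) (m n : nat) :
  q != 0 -> (m < n)%N -> qpoch (q ^- m) q n = 0.
Proof.
move=> q0 lt_mn; apply/eqP/prodf_eq0; exists (Ordinal lt_mn) => //=.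
by rewrite mulVf ?subrr // expf_neq0.
Qed.

Section QSeries.
Variables (F : fieldType) (q : F).
Hypothesis qfact_neq0 : forall m, qpoch q q m != 0.

Lemma qbinom0 n : qbinom q n 0 = 1.
Proof. by rewrite /qbinom qpoch0 mul1r subn0 divff. Qed.

Lemma qbinomn n : qbinom q n n = 1.
Proof. by rewrite /qbinom subnn qpoch0 mulr1 divff. Qed.

Lemma qbinomS n k : (k < n)%N ->
  qbinom q n.+1 k.+1 = qbinom q n k + q ^+ k.+1 * qbinom q n k.+1.
Proof.
move=> lt_kn; rewrite /qbinom subSS -(subnSK lt_kn).
have := qfact_neq0 (n - k.+1).+1; have := qfact_neq0 k.+1.
have -> : qpoch q q n.+1 =
    qpoch q q n * (1 - q ^+ k.+1 * q ^+ (n - k.+1).+1).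
  by rewrite qpochS -exprS -exprD; congr (_ * (1 - _ ^+ _)); lia.
rewrite !qpochS !mulf_eq0 !negb_or !exprS => /andP[k0 k1] /andP[m0 m1].
by field; rewrite k0 k1 m0 m1.
Qed.

(** Pascal's rule [qbinomS] summed against [f], with the shifted half reindexed. It reduces the
    inductions for the q-binomial theorem and for q-Vandermonde to termwise identities. *)
Lemma sum_qbinomS n (f : nat -> F) :
  \sum_(i < n.+2) qbinom q n.+1 i * f i =
  \sum_(i < n.+1) qbinom q n i * (f i.+1 + q ^+ i * f i).
Proof.
under [RHS]eq_bigr do rewrite mulrDr.
rewrite big_split /= [X in _ = X + _]big_ord_recr [X in _ = _ + X]big_ord_recl.
rewrite big_ord_recl big_ord_recr /= !qbinom0 !qbinomn !mul1r.
under eq_bigr => i _ do rewrite /bump /= add1n qbinomS // mulrDl.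
rewrite big_split /=.
under [X in _ = _ + (_ + X)]eq_bigr => i _ do
  rewrite /bump /= add1n mulrCA mulrA.
by ring.
Qed.

Lemma qbinomial_theorem n (x : F) :
  \sum_(i < n.+1) qbinom q n i * ((- x) ^+ i * q ^+ 'C(i, 2)) = qpoch x q n.
Proof.
elim: n x => [|n IHn] x.
  by rewrite big_ord_recr big_ord0 /= qbinom0 qpoch0 !mulr1 add0r.
rewrite (sum_qbinomS n (fun i => (- x) ^+ i * q ^+ 'C(i, 2))) qpochSl -IHn.
rewrite mulr_sumr; apply: eq_bigr => i _.
(* Since ['C(i.+1, 2) = 'C(i, 2) + i], both terms contain [(- x * q) ^+ i * q ^+ 'C(i, 2)], with
   cofactors [- x] and [1]. *)
rewrite binS bin1 exprD exprS -mulNr [(- x * q) ^+ i]exprMn; ring.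
Qed.

(* The limit [N -> oo] of the q-Vandermonde sum
   [\sum_j q^(j(j+s)) [m, j] [N, j+s] = [m+N, m+s]]. *)
Lemma qVandermonde_limit m s :
  \sum_(j < m.+1) qbinom q m j * (q ^+ (j * (j + s)) / qpoch q q (j + s)) =
  (qpoch q q (m + s))^-1.
Proof.
elim: m s => [|m IHm] s.
  by rewrite big_ord_recr big_ord0 /= qbinom0 add0r !mul1r.
rewrite (sum_qbinomS m (fun j => q ^+ (j * (j + s)) / qpoch q q (j + s))).
(* The induction hypothesis is taken at [s.+1]. Over the denominator [qpoch q q (j + s).+1], the two
   numerators are [q ^+ (j * (j + s).+1)] times [q ^+ (j + s).+1] and [1 - q ^+ (j + s).+1]. *)
rewrite addSnnS -IHm; apply: eq_bigr => j _; congr (_ * _).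
rewrite addnS addSn mulSn !mulnS; have := qfact_neq0 (j + s).+1.
rewrite qpochS mulf_eq0 negb_or => /andP[m0 m1].
by rewrite !exprS !exprD; field; rewrite -exprD m0 m1.
Qed.

Definition invqfact (m : int) : F :=
  if m is Posz k then (qpoch q q k)^-1 else 0.

Lemma invqfact_lt0 m : m < 0 -> invqfact m = 0.
Proof. by case: m. Qed.

Lemma qbinom_invqfact n k : (k <= n)%N ->
  qbinom q n k = qpoch q q n * (invqfact k * invqfact (n%:Z - k%:Z)).
Proof. by move=> le_kn; rewrite subzn // /qbinom /= invfM. Qed.

(* The sum over all integers truncated at [N], which is exact for [n <= N]. *)
Definition bailey (N : nat) (alpha : int -> F) (n : nat) : F :=
  \sum_(r <- symrange N) alpha r * (invqfact (n%:Z - r) * invqfact (n%:Z + r)).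

(** The Bailey step on a single index [r]. Both sides are even in [r], so let [r = s >= 0]. Terms
    with [k < s] vanish; putting [k = j + s] and using [(j + s)^2 = s^2 + j * (j + 2 * s)] leaves
    [qVandermonde_limit] with [m = n - s] and shift [2 * s]. *)
Lemma bailey_kernel n (r : int) :
  \sum_(k < n.+1) q ^+ (k ^ 2) * invqfact (n%:Z - k%:Z) *
     (invqfact (k%:Z - r) * invqfact (k%:Z + r)) =
  q ^+ (absz r ^ 2) * (invqfact (n%:Z - r) * invqfact (n%:Z + r)).
Proof.
wlog [s ->] : r / exists s : nat, r = s.
  move=> IH; case: (intP r) => [|s|s]; try by apply: IH; eexists.
  rewrite abszN opprK [X in _ = _ * X]mulrC -(IH s.+1%:Z); last by eexists.
  by apply: eq_bigr => k _; rewrite [X in _ = _ * X]mulrC.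
have [le_sn | lt_ns] := leqP s n; last first.
  rewrite (invqfact_lt0 (_ : n%:Z - s%:Z < 0)) ?mul0r ?mulr0; last by lia.
  apply: big1 => k _.
  rewrite (invqfact_lt0 (_ : k%:Z - s%:Z < 0)) ?mul0r ?mulr0 //.
  by have := ltn_ord k; lia.
rewrite -(big_mkord xpredT (fun k : nat =>
     q ^+ (k ^ 2) * invqfact (n%:Z - k%:Z) *
     (invqfact (k%:Z - s%:Z) * invqfact (k%:Z + s%:Z)))).
rewrite (big_cat_nat (n := s)) //=; last by lia.
rewrite big_nat big1 ?add0r; last first.
  move=> k /andP[_ lt_ks].
  by rewrite (invqfact_lt0 (_ : k%:Z - s%:Z < 0)) ?mul0r ?mulr0 //; lia.
rewrite -[X in \sum_(X <= _ < _) _]add0n big_addn subSn // big_mkord.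
rewrite subzn //.
have -> : (n + s = (n - s) + (2 * s))%N by lia.
rewrite -qVandermonde_limit !mulr_sumr; apply: eq_bigr => j _.
have le_j : (j <= n - s)%N by rewrite -ltnS ltn_ord.
rewrite qbinom_invqfact // [invqfact (n - s)%N]/=.
have -> : (j + s)%N%:Z - s%:Z = j by lia.
have -> : (j + s + s = j + 2 * s)%N by lia.
have -> : n%:Z - (j + s)%N%:Z = (n - s)%N%:Z - j%:Z by lia.
have -> : ((j + s) ^ 2 = s ^ 2 + j * (j + 2 * s))%N by nia.
rewrite exprD /=; field.
by rewrite !qfact_neq0.
Qed.

(** After exchanging the sums, [bailey_kernel] applies to each [r] separately, so any truncation [N]
    is allowed. *)
Lemma bailey_step N alpha n :
  \sum_(k < n.+1) q ^+ (k ^ 2) * invqfact (n%:Z - k%:Z) * bailey N alpha k =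
  bailey N (fun r => q ^+ (absz r ^ 2) * alpha r) n.
Proof.
rewrite /bailey; under eq_bigr do rewrite mulr_sumr.
rewrite exchange_big /=; apply: eq_bigr => r _.
rewrite [_ * alpha r]mulrC -[RHS]mulrA -bailey_kernel mulr_sumr.
by apply: eq_bigr => k _; rewrite mulrCA.
Qed.

(** The division is exact, because [r * (r - 1)] is even. *)
Definition unit_alpha (r : int) : F := (-1) ^ r * q ^ ((r * (r - 1)) %/ 2)%Z.

Lemma unit_bailey_pair N n : q != 0 -> (n <= N)%N ->
  bailey N unit_alpha n = (n == 0%N)%:R.
Proof.
move=> q0 le_nN; rewrite /bailey (symrange_sum_widen le_nN); last first.
  move=> r lt_nr; have [r0|r0] := leP 0 r.
    by rewrite (invqfact_lt0 (_ : n%:Z - r < 0)) ?mul0r ?mulr0 //; lia.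
  by rewrite (invqfact_lt0 (_ : n%:Z + r < 0)) ?mul0r ?mulr0 //; lia.
rewrite symrange_sumE.
(* With [r = i - n], the sum is the q-binomial theorem of order [2 * n] at [x = q ^- n]. For [n > 0]
   the product contains the zero factor [1 - q ^- n * q ^+ n]. *)
transitivity ((-1) ^+ n * q ^+ 'C(n.+1, 2) / qpoch q q (2 * n)
   * qpoch (q ^- n) q (2 * n)); last first.
  case: n {le_nN} => [|n]; first by rewrite !qpoch0 !mulr1 divr1.
  by rewrite qpoch_eq0 ?mulr0 //; lia.
rewrite -(qbinomial_theorem _ (q ^- n)) mulr_sumr; apply: eq_bigr => i _.
have le_i : (i <= 2 * n)%N by rewrite -ltnS ltn_ord.
rewrite qbinom_invqfact //.
have -> : n%:Z - (i%:Z - n%:Z) = (2 * n)%N%:Z - i%:Z by lia.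
have -> : n%:Z + (i%:Z - n%:Z) = i by lia.
have C2 (m : nat) : m%:Z * (m%:Z - 1) = 2 * 'C(m, 2)%:Z.
  case: m => [|m]; first by rewrite mul0r bin_small.
  have : (m.+1 * m = 2 * 'C(m.+1, 2))%N by rewrite -mul_bin_diag bin1.
  by lia.
have -> : unit_alpha (i%:Z - n%:Z) =
    (-1) ^+ n * q ^+ 'C(n.+1, 2) * ((- q ^- n) ^+ i * q ^+ 'C(i, 2)).
  rewrite /unit_alpha.
  (* The cross term [- n * i] in half the product is what supplies the power [(q ^- n) ^+ i]. *)
  have -> : ((i%:Z - n%:Z) * (i%:Z - n%:Z - 1) =
     ('C(n.+1, 2)%:Z + 'C(i, 2)%:Z - (n * i)%N%:Z) * 2)%R.
    by have := C2 n.+1; have := C2 i; lia.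
  rewrite mulzK // !expfzDr ?oppr_eq0 ?oner_eq0 // -!exprnN -!exprnP.
  rewrite -[_ ^- n]exprVn invrN1 [(- q ^- n) ^+ i]exprNn exprVn exprM.
  by ring.
by field; rewrite qfact_neq0.
Qed.

End QSeries.

Lemma qfact_neq0_lt1 (F : numFieldType) (q : F) (m : nat) :
  `|q| < 1 -> qpoch q q m != 0.
Proof.
move=> q1; apply/prodf_neq0 => i _; rewrite -exprS subr_eq0.
have: `|q ^+ i.+1| < 1 by rewrite normrX exprn_ilt1.
by apply: contraTneq => <-; rewrite normr1 ltxx.
Qed.

Theorem corollary3p7 (R : realType) (q : complex R)
    (hq0 : 0 < `|q|) (hq1 : `|q| < 1) (n : nat) :
  \sum_(k <- symrange n)
     qbinom q (2 * n) (absz (n%:Z + k)) * (-1) ^ k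
       * q ^ (((5 * k - 1) * k) %/ 2)%Z
  = qbinom q (2 * n) n * qpoch q q n
      * \sum_(0 <= k < n.+1) qbinom q n k * q ^+ (k ^ 2).
Proof.
have q0 : q != 0 by rewrite -normr_gt0.
have qf m : qpoch q q m != 0 by exact: qfact_neq0_lt1.
pose step (alpha : int -> complex R) r := q ^+ (absz r ^ 2) * alpha r.
transitivity (qpoch q q (2 * n) * bailey q n (step (step (unit_alpha q))) n).
  rewrite /bailey !symrange_sumE mulr_sumr; apply: eq_bigr => i _.
  have le_i : (i <= 2 * n)%N by rewrite -ltnS ltn_ord.
  set r := i%:Z - n%:Z.
  have -> : n%:Z + r = i by rewrite /r; lia.
  have -> : n%:Z - r = (2 * n)%N%:Z - i%:Z by rewrite /r; lia.
  rewrite qbinom_invqfact // /step /unit_alpha.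
  (* Each of the two Bailey steps contributes [r^2] to the exponent, on top of [r * (r - 1) / 2]. *)
  have -> : (5 * r - 1) * r =
      ((absz r ^ 2)%N%:Z + (absz r ^ 2)%N%:Z) * 2 + r * (r - 1) by nia.
  by rewrite divzMDl // !(expfzDr _ _ q0) absz_nat -!(exprnP q); ring.
rewrite -bailey_step // big_mkord !mulr_sumr; apply: eq_bigr => k _.
have le_k : (k <= n)%N by rewrite -ltnS ltn_ord.
(* In the inner sum only index [0] survives, leaving [1 / (q;q)_k]; the truncation at [n] is exact
   there because all inner indices are at most [k <= n]. *)
rewrite -bailey_step // big_ord_recl big1 => [|i _]; last first.
  by rewrite unit_bailey_pair ?mulr0 //= /bump; have := ltn_ord i; lia.
rewrite unit_bailey_pair //= addn0 mulr1 mul1r addr0.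
rewrite !qbinom_invqfact //; last by lia.
have -> : (2 * n)%N%:Z - n%:Z = n by lia.
by rewrite subzn //=; field; rewrite !qf.
Qed.
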